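(* Let $\Gamma$ be a connected trivalent graph and $G\le\mathrm{Aut}(\Gamma)$ act vertex-transitively, but not edge-transitively, on $\Gamma$, with infinite vertex stabilizers. Then for every $s\ge1$ and each colour $c\in\{\text{red},\text{blue}\}$, $G$ acts transitively on the set of all alternating $s$-arcs $(\alpha_0,\dots,\alpha_s)$ whose first edge $\{\alpha_0,\alpha_1\}$ has colour $c$.
   Context: Graphs are simple. An $s$-arc is a tuple $(\alpha_0,\dots,\alpha_s)$ of vertices with each $\{\alpha_i,\alpha_{i+1}\}$ an edge and $\alpha_{i-1}\neq\alpha_{i+1}$ for $1\le i\le s-1$. Under the hypotheses, $G$ has exactly two orbits on edges and each vertex is incident with exactly one edge of one orbit, whose edges are called red, and two edges of the other orbit, whose edges are called blue. An $s$-arc is alternating if consecutive edges $\{\alpha_{i-1},\alpha_i\}$ and $\{\alpha_i,\alpha_{i+1}\}$ have different colours. *)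

(* Defs.v *)
From Stdlib Require Import Relation_Operators.
From mathcomp Require Import all_boot.
From mathcomp Require Import boolp classical_sets functions cardinality.

Set Implicit Arguments.
Unset Strict Implicit.
Unset Printing Implicit Defensive.

Local Open Scope classical_set_scope.
Local Open Scope card_scope.

(* Simple graphs, with a possibly infinite vertex set. *)
Record sgraph := SGraph {
  vertex :> Type;
  adj : vertex -> vertex -> Prop;
  adj_sym : forall x y, adj x y -> adj y x;
  adj_irrefl : forall x, ~ adj x x
}.
Arguments adj {s} _ _.

Definition connected_graph (Gam : sgraph) : Prop :=
  forall x y : Gam, clos_refl_trans Gam adj x y.

Definition trivalent (Gam : sgraph) : Prop :=
  forall v : Gam, [set w : Gam | adj v w] #= `I_3.

Definition edges (Gam : sgraph) : set (set Gam) :=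
  [set e | exists x y : Gam, adj x y /\ e = [set x; y]].

Definition automorphism (Gam : sgraph) (g : Gam -> Gam) : Prop :=
  bijective g /\ forall x y : Gam, adj (g x) (g y) <-> adj x y.

Record subgroup_of_aut (Gam : sgraph) (G : set (Gam -> Gam)) : Prop := {
  subgroup_aut : forall g, G g -> automorphism g;
  subgroup_id : G id;
  subgroup_comp : forall g h, G g -> G h -> G (g \o h);
  subgroup_inv : forall g h, G g -> cancel g h -> cancel h g -> G h
}.

Definition stabilizer (Gam : sgraph) (G : set (Gam -> Gam)) (v : Gam) :
    set (Gam -> Gam) :=
  [set g | G g /\ g v = v].

(* [act g x] is the image of the point [x] under [g]. *)
Definition transitive_on (Gam : sgraph) (G : set (Gam -> Gam)) (X : Type)
    (act : (Gam -> Gam) -> X -> X) (A : set X) : Prop :=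
  forall x y, A x -> A y -> exists2 g, G g & act g x = y.

Definition vertex_transitive (Gam : sgraph) (G : set (Gam -> Gam)) : Prop :=
  transitive_on G (fun g v => g v) [set: Gam].

Definition edge_transitive (Gam : sgraph) (G : set (Gam -> Gam)) : Prop :=
  transitive_on G (fun g e => g @` e) (@edges Gam).

Definition edge_orbit (Gam : sgraph) (G : set (Gam -> Gam)) (e : set Gam) :
    set (set Gam) :=
  [set f | exists2 g, G g & g @` e = f].

Inductive colour := Red | Blue.

(* An edge is red (resp. blue) when every vertex is incident with exactly one
   (resp. two) of the edges in its [G]-orbit. When [G] is vertex-transitive but
   not edge-transitive on a connected trivalent graph, with infinite vertex
   stabilizers, there are exactly two edge orbits, one of each colour. *)
Definition has_colour (Gam : sgraph) (G : set (Gam -> Gam)) (c : colour)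
    (e : set Gam) : Prop :=
  edges e /\
  forall v : Gam,
    [set f | edge_orbit G e f /\ f v] #= `I_(if c is Red then 1 else 2).

Definition is_arc (Gam : sgraph) (s : nat) (a : 'I_s.+1 -> Gam) : Prop :=
  (forall i j : 'I_s.+1, j = i.+1 :> nat -> edges [set a i; a j]) /\
  (forall i j k : 'I_s.+1, j = i.+1 :> nat -> k = j.+1 :> nat -> a i <> a k).

Definition alternating (Gam : sgraph) (G : set (Gam -> Gam)) (s : nat)
    (a : 'I_s.+1 -> Gam) : Prop :=
  forall i j k : 'I_s.+1, j = i.+1 :> nat -> k = j.+1 :> nat ->
    exists c d : colour,
      [/\ c <> d, has_colour G c [set a i; a j] & has_colour G d [set a j; a k]].

(* [inord 1] is the index 1 only if [0 < s]; for [s = 0] it is 0. *)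
Definition alternating_arcs (Gam : sgraph) (G : set (Gam -> Gam)) (s : nat)
    (c : colour) : set ('I_s.+1 -> Gam) :=
  [set a | [/\ is_arc a, alternating G a
             & has_colour G c [set a ord0; a (inord 1)]]].
Arguments alternating_arcs {Gam} G s c _.

(* Main.v *)
From Stdlib Require Import Relation_Operators.
Require Import Defs.
From mathcomp Require Import all_boot.
From mathcomp Require Import boolp classical_sets functions cardinality.

Local Open Scope classical_set_scope.

Set Implicit Arguments.
Unset Strict Implicit.
Unset Printing Implicit Defensive.

(** The red neighbour of [v] is its only neighbour fixed by the stabilizer
    [G_v]; it defines a [G]-equivariant involution [r] of the vertices. Since
    red edges do not branch, alternating arcs amount to paths of the digraph
    [v -> w] iff [v] and [r w] are joined by a blue edge, in which every vertex
    has two successors and reversal is [w |-> r w]. If [G] is transitive on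
    [k]-paths but not on [(k+1)]-paths, then the stabilizer of any [k]-path
    fixes both successors of its end. Sliding the path forward, and reversing
    it, such a stabilizer fixes every vertex of the connected graph, so it is
    trivial. As it has index at most [2 ^ k] in a vertex stabilizer, the latter
    is finite, a contradiction. *)

(** * Unordered pairs *)

Lemma set2_inj (T : Type) (a b x y : T) :
  [set a; b] = [set x; y] -> (a = x /\ b = y) \/ (a = y /\ b = x).
Proof.
move=> e.
have [aP bP] : [set x; y] a /\ [set x; y] b.
  by rewrite -e; split; [left | right].
have [xP yP] : [set a; b] x /\ [set a; b] y.
  by rewrite e; split; [left | right].
case: aP bP xP yP => /= ax [] /= bx [] /= xa [] /= ya;
  by [left; split; congruence | right; split; congruence].
Qed.

Lemma image_set2 (T U : Type) (f : T -> U) (a b : T) :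
  f @` [set a; b] = [set f a; f b].
Proof. by rewrite image_setU !image_set1. Qed.

(** * Edge orbits, connectivity and neighbourhoods *)

Section VertexTransitive.
Context {Gam : sgraph} {G : set (Gam -> Gam)}.
Hypothesis conn : connected_graph Gam.
Hypothesis triv : trivalent Gam.
Hypothesis subG : subgroup_of_aut G.
Hypothesis vtr : vertex_transitive G.

Lemma subgroup_inverse (g : Gam -> Gam) :
  G g -> exists h, [/\ G h, cancel g h & cancel h g].
Proof.
move=> Gg; have [[h gK hK] _] := subgroup_aut subG Gg.
by exists h; split=> //; apply: subgroup_inv gK hK.
Qed.

Lemma subgroup_inj (g : Gam -> Gam) : G g -> injective g.
Proof. by move=> /(subgroup_aut subG)[/bij_inj]. Qed.

Lemma adj_act (g : Gam -> Gam) (x y : Gam) : G g -> adj x y -> adj (g x) (g y).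
Proof. by move=> /(subgroup_aut subG)[_ /(_ x y)[]]. Qed.

Lemma edge_orbit_sym (e f : set Gam) : edge_orbit G e f -> edge_orbit G f e.
Proof.
move=> [g Gg <-]; have [h [Gh gK _]] := subgroup_inverse Gg.
exists h => //; rewrite image_comp -[RHS]image_id.
by congr (_ @` _); apply/funext.
Qed.

Lemma edge_orbit_trans (e f k : set Gam) :
  edge_orbit G e f -> edge_orbit G f k -> edge_orbit G e k.
Proof.
move=> [g Gg <-] [h Gh <-]; exists (h \o g); first exact: subgroup_comp.
by rewrite image_comp.
Qed.

Lemma edge_orbit_act (g : Gam -> Gam) (a b : Gam) :
  G g -> edge_orbit G [set a; b] [set g a; g b].
Proof. by move=> Gg; exists g; rewrite ?image_set2. Qed.

(** Vertex-transitivity moves any edge to one through [v], so only the edges at [v] have to be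
    compared. *)
Lemma edge_transitive_at (v w0 : Gam) :
  (forall w, adj v w -> edge_orbit G [set v; w0] [set v; w]) ->
  edge_transitive G.
Proof.
move=> H; suff E e : edges e -> edge_orbit G [set v; w0] e.
  move=> e f /E /edge_orbit_sym e0 /E f0.
  by have [g] := edge_orbit_trans e0 f0; exists g.
move=> [x [y [xy ->]]]; have [g Gg gx] := @vtr x v I I.
apply: edge_orbit_trans (edge_orbit_sym (edge_orbit_act x y Gg)).
by rewrite gx; apply: H; rewrite -gx; apply: adj_act.
Qed.

Lemma connected_ind (P : Gam -> Prop) (v : Gam) :
  P v -> (forall x y, adj x y -> P x -> P y) -> forall w, P w.
Proof.
move=> Pv Padj w; move: (conn v w) Pv.
by elim=> [x y /Padj|x|x y z _ IH1 _ IH2 /IH1 /IH2].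
Qed.

Lemma trivalent_third (v x y : Gam) : adj v x -> adj v y -> x <> y ->
  exists2 z, adj v z & forall w, adj v w -> [\/ w = x, w = y | w = z].
Proof.
have /card_set_bijP [f [ff fi fs]] := triv v.
have inj a b : adj v a -> adj v b -> f a = f b -> a = b.
  by move=> va vb; apply: fi; rewrite inE.
move=> vx vy xy; have fxy : f x <> f y by move=> /(inj _ _ vx vy).
(* [n] is the label in [{0, 1, 2}] left over by [x] and [y]; the rest is a finite check on
   labels. *)
have [n n3 [nx ny]] : exists2 n, n < 3 & n <> f x /\ n <> f y.
  move: (ff _ vx) (ff _ vy) fxy => /=.
  move: (f x) (f y) => [|[|[|//]]] [|[|[|//]]] _ _ //;
  move=> _; by [exists 0 | exists 1 | exists 2].
have [z vz fz] := fs n n3.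
exists z => // w vw.
suff : [\/ f w = f x, f w = f y | f w = f z].
  by case=> /inj e; [apply: Or31 | apply: Or32 | apply: Or33]; apply: e.
rewrite {}fz; move: (ff _ vx) (ff _ vy) (ff _ vw) n3 fxy nx ny => /=.
move: (f x) (f y) (f w) n => [|[|[|//]]] [|[|[|//]]] [|[|[|//]]] [|[|[|//]]] //;
move=> *; by [apply: Or31 | apply: Or32 | apply: Or33].
Qed.

(** * Red and blue neighbours of a vertex *)

Section InfiniteStabilizers.
Hypothesis netr : ~ edge_transitive G.
Hypothesis inf : forall v : Gam, infinite_set (stabilizer G v).

Definition red (v z : Gam) : Prop :=
  adj v z /\ forall g, G g -> g v = v -> g z = z.

Definition blue (v z : Gam) : Prop := adj v z /\ ~ red v z.

(** Otherwise, by conjugation, each vertex stabilizer fixes all neighbours of its vertex; by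
    connectivity the stabilizer of [v] is then trivial, hence finite. *)
Lemma stabilizer_moves_neighbour (v : Gam) :
  exists x g, [/\ adj v x, G g, g v = v & g x <> x].
Proof.
apply: contrapT => nx.
have fixv x g : adj v x -> G g -> g v = v -> g x = x.
  by move=> vx Gg gv; apply: contrapT => gx; apply: nx; exists x, g.
apply: (inf (v := v)); apply: (@sub_finite_set _ _ [set id]) => [g [Gg gv]|];
  last exact: finite_set1.
rewrite /=; apply/funext; apply: (connected_ind (v := v)) => // x y xy gx.
have [h Gh hx] := @vtr x v I I; have [k [Gk hK kK]] := subgroup_inverse Gh.
have := fixv (h y) (h \o g \o k).
rewrite -hx /= hK gx => /(_ (adj_act Gh xy)); rewrite hK.
move=> /(_ _ erefl) /= e; apply: (subgroup_inj Gh); apply: e.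
by apply: subgroup_comp => //; apply: subgroup_comp.
Qed.

(** Some [g] fixing [v] moves a neighbour [x]; let [z] be the neighbour other than [x] and [g x]. An
    element fixing [v] and moving [z] would send it to [x] or [g x], putting all three edges at [v]
    in one orbit. *)
Lemma local_structure (v : Gam) : exists x y z g,
  [/\ blue v x, blue v y, red v z, G g & g v = v] /\
  [/\ x <> y, g x = y & forall w, adj v w -> [\/ w = x, w = y | w = z]].
Proof.
have [x [g [vx Gg gv gx]]] := stabilizer_moves_neighbour v.
have vgx : adj v (g x) by rewrite -{1}gv; apply: adj_act.
have [z vz nb] := trivalent_third vx vgx (fun e => gx (esym e)).
exists x, (g x), z, g; split; split=> //; last by move=> e; apply: gx.
- by split=> // -[_ /(_ g Gg gv)].
- split=> // -[_ /(_ g Gg gv) /(subgroup_inj Gg)]; exact: gx.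
split=> // h Gh hv; apply: contrapT => hz; apply: netr.
have ogx : edge_orbit G [set v; x] [set v; g x].
  by have := edge_orbit_act v x Gg; rewrite gv.
have oxx := edge_orbit_act v x (subgroup_id subG).
apply: (@edge_transitive_at v x) => w /nb[]-> //.
have := edge_orbit_sym (edge_orbit_act v z Gh); rewrite hv.
have vhz : adj v (h z) by rewrite -{1}hv; apply: adj_act.
by case: (nb _ vhz) => // ->; apply: edge_orbit_trans.
Qed.

Lemma red_exists (v : Gam) : exists z, red v z.
Proof. by have [x [y [z [g [[]]]]]] := local_structure v; exists z. Qed.

Lemma red_uniq (v z z' : Gam) : red v z -> red v z' -> z = z'.
Proof.
have [x [y [t [g [[[_ nx] [_ ny] _ _ _] [_ _ nb]]]]]] := local_structure v.
suff E u : red v u -> u = t by move=> /E-> /E->.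
by move=> /[dup] -[/nb[] -> _].
Qed.

Lemma blue_two (v x y w : Gam) :
  blue v x -> blue v y -> blue v w -> x <> y -> w = x \/ w = y.
Proof.
have [x0 [y0 [z [g [[_ _ rz _ _] [_ _ nb]]]]]] := local_structure v.
have E u : blue v u -> u = x0 \/ u = y0.
  by move=> [/nb[]->]; [left | right | case].
by move=> /E[]-> /E[]-> /E[]->; tauto.
Qed.

Lemma blue_swap (v x : Gam) : blue v x ->
  exists g, [/\ G g, g v = v & g x <> x].
Proof.
move=> [vx nrx]; apply: contrapT => H; apply: nrx; split=> // g Gg gv.
by apply: contrapT => gx; apply: H; exists g.
Qed.

Lemma red_act (g : Gam -> Gam) (a b : Gam) : G g -> red a b -> red (g a) (g b).
Proof.
move=> Gg [ab fb]; split=> [|h Gh hga]; first exact: adj_act.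
have [k [Gk gK kK]] := subgroup_inverse Gg.
apply: (can_inj kK); rewrite gK; apply: (fb (k \o h \o g)).
  by apply: subgroup_comp => //; apply: subgroup_comp.
by rewrite /= hga gK.
Qed.

Lemma blue_act (g : Gam -> Gam) (a b : Gam) :
  G g -> blue a b -> blue (g a) (g b).
Proof.
move=> Gg [ab nr]; split=> [|r]; first exact: adj_act.
have [k [Gk gK kK]] := subgroup_inverse Gg.
by apply: nr; have := red_act Gk r; rewrite !gK.
Qed.

(** The stabilizer of [v] fuses the two blue edges at [v], so a common orbit with the red one would
    give edge-transitivity. *)
Lemma red_blue_orbits (v z x : Gam) :
  red v z -> blue v x -> ~ edge_orbit G [set v; z] [set v; x].
Proof.
move=> rz bx oz; apply: netr; apply: (@edge_transitive_at v z) => w vw.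
have [rw|nrw] := pselect (red v w).
  by rewrite (red_uniq rw rz); apply: (edge_orbit_act v z (subgroup_id subG)).
have bw : blue v w by [].
have [->//|wx] := pselect (w = x).
have [g [Gg gv gx]] := blue_swap bx.
have bgx : blue v (g x) by rewrite -{1}gv; apply: blue_act.
case: (blue_two bx bgx bw (fun e => gx (esym e))) => [//|->].
by apply: edge_orbit_trans oz _; have := edge_orbit_act v x Gg; rewrite gv.
Qed.

(** An element taking [a] to [b] takes the edge [{a, b}] to the red edge at [b]. Were [a] blue for
    [b], that orbit would contain both a red and a blue edge at [b]. *)
Lemma red_sym (a b : Gam) : red a b -> red b a.
Proof.
move=> rab; apply: contrapT => nba.
have [g Gg ga] := @vtr a b I I.
have rb : red b (g b) by rewrite -{1}ga; apply: red_act.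
apply: (red_blue_orbits rb (x := a)); first by split=> //; apply: adj_sym rab.1.
rewrite (setUC [set b] [set a]); apply: edge_orbit_sym.
by have := edge_orbit_act a b Gg; rewrite ga.
Qed.

Lemma blue_sym (a b : Gam) : blue a b -> blue b a.
Proof. by move=> [ab nr]; split=> [|/red_sym//]; apply: adj_sym. Qed.

(** * Edge colours, defined by orbit counts, in terms of stabilizers *)

Lemma edges_adj (a b : Gam) : edges [set a; b] -> adj a b.
Proof. by move=> [x [y [xy e]]]; case: (set2_inj e) => -[-> ->] //; apply: adj_sym. Qed.

(** If some [g] fixing [a] moved [b], the orbit would contain two edges at [a], namely [{a, b}] and
    [{a, g b}]. *)
Lemma has_colour_Red (a b : Gam) : has_colour G Red [set a; b] -> red a b.
Proof.
move=> [/edges_adj ab /(_ a) /card_set_bijP[f [ff fi _]]].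
apply: contrapT => nr; have [g [Gg ga gb]] := blue_swap (conj ab nr).
pose A := [set f | edge_orbit G [set a; b] f /\ f a].
have A1 : A [set a; b].
  by split; [apply: (edge_orbit_act a b (subgroup_id subG)) | left].
have A2 : A [set a; g b].
  by split; [have := edge_orbit_act a b Gg; rewrite ga | left].
have fE x : A x -> f x = 0 by move=> /ff /=; case: (f x).
have := fi [set a; b] [set a; g b].
rewrite !inE fE // fE // => /(_ A1 A2 erefl) e.
apply: gb; case: (set2_inj e) => -[e1 e2]; first by rewrite -e2.
by rewrite -e1 e2.
Qed.

(** If [b] were the red neighbour of [a], any edge of the orbit through [a] would be red, hence
    [{a, b}] itself, against the count of two. *)
Lemma has_colour_Blue (a b : Gam) : has_colour G Blue [set a; b] -> blue a b.
Proof.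
move=> [/edges_adj ab /(_ a) /card_set_bijP[f [_ _ fs]]]; split=> // rab.
have uniqA e : edge_orbit G [set a; b] e /\ e a -> e = [set a; b].
  case=> -[g Gg <-]; rewrite image_set2 => -[] /= ae.
    by rewrite -ae (rab.2 g Gg (esym ae)).
  have := red_sym (red_act Gg rab); rewrite -ae => /red_uniq/(_ rab) ->.
  by rewrite setUC.
have [e0 /uniqA -> f0] := fs 0 isT; have [e1 /uniqA -> f1] := fs 1 isT.
by rewrite f0 in f1.
Qed.

(** * The red involution and transitivity on paths of the digraph *)

Lemma red_involution : exists r : Gam -> Gam,
  [/\ forall v, red v (r v), involutive r &
      forall g v, G g -> r (g v) = g (r v)].
Proof.
have [r rP] := choice red_exists; exists r; split=> //.
  by move=> v; apply: (red_uniq (rP _)); apply: red_sym.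
by move=> g v Gg; apply: (red_uniq (rP _)); apply: red_act.
Qed.

Section Paths.
Variable r : Gam -> Gam.
Hypothesis r_red : forall v, red v (r v).
Hypothesis rK : involutive r.
Hypothesis r_act : forall g v, G g -> r (g v) = g (r v).

Definition step (v w : Gam) : Prop := blue v (r w).

Lemma step_act (g : Gam -> Gam) (v w : Gam) :
  G g -> step v w -> step (g v) (g w).
Proof. by move=> Gg; rewrite /step r_act //; apply: blue_act. Qed.

Lemma step_exists (v : Gam) : exists w, step v w.
Proof.
have [x [_ [_ [_ [[bx _ _ _ _] _]]]]] := local_structure v.
by exists (r x); rewrite /step rK.
Qed.

Lemma step_two (v x y w : Gam) :
  step v x -> step v y -> step v w -> x <> y -> w = x \/ w = y.
Proof.
move=> vx vy vw xy; have rI := can_inj rK.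
by case: (blue_two vx vy vw) => [/rI//|/rI ->|/rI ->]; [left | right].
Qed.

Lemma step_rev (v w : Gam) : step v w -> step (r w) (r v).
Proof. by move=> /blue_sym; rewrite /step rK. Qed.

(* A path of length [k] is a function on [nat] whose values beyond [k] are
   irrelevant. *)
Definition steps (k : nat) (p : nat -> Gam) : Prop :=
  forall i, i < k -> step (p i) (p i.+1).

Definition fixes (g : Gam -> Gam) (k : nat) (p : nat -> Gam) : Prop :=
  forall i, i <= k -> g (p i) = p i.

Definition rigid (k : nat) : Prop :=
  forall p g w, steps k p -> G g -> fixes g k p -> step (p k) w -> g w = w.

Lemma fixes_inv (g h : Gam -> Gam) (k : nat) (p : nat -> Gam) :
  cancel g h -> fixes g k p -> fixes h k p.
Proof. by move=> gK gp i ik; rewrite -{1}(gp i ik) gK. Qed.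

Lemma rigid_id (k : nat) (p : nat -> Gam) (g : Gam -> Gam) :
  rigid k -> steps k p -> G g -> fixes g k p -> forall w, g w = w.
Proof.
move=> rig sp Gg gp.
(* [P v] says that [v] ends a [k]-path fixed pointwise by [g]; it is shown to propagate along all
   edges. *)
pose P v := exists q, [/\ steps k q, fixes g k q & q k = v].
have Pfix v : P v -> g v = v by move=> [q [_ gq <-]]; apply: gq.
have Pstep v w : P v -> step v w -> P w.
  move=> [q [sq gq <-]] qw.
  (* Slide [q] forward: drop its first vertex and append [w], fixed by rigidity. *)
  exists (fun i => if i < k then q i.+1 else w); rewrite ltnn; split=> //.
    move=> i ik; rewrite ik; case: ltnP => [ik'|ki]; first exact: sq.
    by have -> : i.+1 = k by apply/eqP; rewrite eqn_leq ik.
  by move=> i ik; case: ltnP => ik'; [apply: gq | apply: rig qw].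
have Pr v : P v -> P (r v).
  (* Walk [k] steps forward from [v], staying in [P] so that [g] fixes the walk; applying [r] and
     reversing gives a fixed path ending at [r v]. *)
  move=> Pv; have [s sP] := choice step_exists.
  have Ps i : P (iter i s v) by elim: i => //= i IH; apply: Pstep IH (sP _).
  exists (fun i => r (iter (k - i) s v)); split=> [i ik|i ik|].
  - by rewrite subnS; apply: step_rev; rewrite -{2}(@prednK (k - i)) ?subn_gt0.
  - by rewrite -r_act // Pfix.
  - by rewrite subnn.
have Pall : forall v, P v.
  apply: (connected_ind (v := p k)); first by exists p.
  move=> x y xy Px; have [rxy|nr] := pselect (red x y).
    by rewrite (red_uniq rxy (r_red x)); apply: Pr.
  (* A blue edge from [x] to [y] is a step from [x] to [r y] followed by [r]. *)
  by rewrite -[y]rK; apply/Pr/(Pstep x); rewrite // /step rK.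
by move=> w; apply: Pfix.
Qed.

(* Going down one vertex at a time, the index is at most two at each step. *)
Lemma rigid_finite (k : nat) (p : nat -> Gam) :
  rigid k -> steps k p -> finite_set (stabilizer G (p 0)).
Proof.
move=> rig sp.
pose S j := [set g | G g /\ fixes g j p].
suff /(_ k) : forall j, j <= k -> finite_set (S (k - j)).
  rewrite subnn => /(_ (leqnn k)); apply: sub_finite_set => g [Gg g0].
  by split=> // i; rewrite leqn0 => /eqP ->.
elim=> [_|j IH jk].
  rewrite subn0; apply: (@sub_finite_set _ _ [set id]); last exact: finite_set1.
  by move=> g [Gg gp]; apply/funext; apply: rigid_id gp.
have {IH} := IH (ltnW jk); rewrite subnS.
have : 0 < k - j by rewrite subn_gt0.
have : k - j <= k by rewrite leq_subr.
case: (k - j) => //= m mk _ fin {j jk}.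
have fixS g : fixes g m p -> g (p m.+1) = p m.+1 -> fixes g m.+1 p.
  by move=> gp gm i; rewrite leq_eqVlt => /predU1P[->|] //; apply: gp.
(* If no such [h] exists, [S m] lies in [S m.+1]. Otherwise each [g] in [S m] sends [p m.+1] to
   itself or to [h (p m.+1)], so it lies in [S m.+1] or in its coset by [h]. *)
have [[h [[Gh hp] hm]]|nh] := pselect (exists h, S m h /\ h (p m.+1) <> p m.+1);
  last first.
  apply: sub_finite_set fin => g [Gg gp]; split=> //; apply: fixS => //.
  by apply: contrapT => gm; apply: nh; exists g.
have [h' [Gh' hK h'K]] := subgroup_inverse Gh.
apply: (@sub_finite_set _ _ (S m.+1 `|` (fun g => h \o g) @` S m.+1)); last first.
  by rewrite finite_setU; split=> //; apply: finite_image.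
move=> g [Gg gp]; have pm := sp m mk.
have succ f : S m f -> step (p m) (f (p m.+1)).
  by move=> [Gf fp]; rewrite -{1}(fp m (leqnn m)); apply: step_act.
have hm' : p m.+1 <> h (p m.+1) by move=> e; apply: hm.
have [e|e] := step_two pm (succ h (conj Gh hp)) (succ g (conj Gg gp)) hm'.
  by left; split=> //; apply: fixS.
right; exists (h' \o g); last by apply/funext => x /=; rewrite h'K.
split; first exact: subgroup_comp.
apply: fixS => [i im|] /=; last by rewrite e hK.
by rewrite gp // (fixes_inv hK hp).
Qed.

(** Induction on [k]: once the first [k] steps are matched, the last vertices can fail to be matched
    only if [k] is rigid, and [rigid_finite] excludes that. *)
Lemma steps_transitive (k : nat) (p q : nat -> Gam) : steps k p -> steps k q ->
  exists2 g, G g & forall i, i <= k -> g (p i) = q i.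
Proof.
elim: k p q => [|k IH] p q sp sq.
  have [g Gg g0] := @vtr (p 0) (q 0) I I.
  by exists g => // i; rewrite leqn0 => /eqP ->.
have spk : steps k p by move=> i ik; apply: sp; apply: leqW.
have sqk : steps k q by move=> i ik; apply: sq; apply: leqW.
have [g Gg gpq] := IH p q spk sqk.
suff [h [Gh hq hgp]] :
    exists h, [/\ G h, fixes h k q & h (g (p k.+1)) = q k.+1].
  exists (h \o g); first exact: subgroup_comp.
  move=> i; rewrite leq_eqVlt => /predU1P[->//|ik] /=.
  by rewrite gpq // hq.
have sw : step (q k) (g (p k.+1)).
  by rewrite -gpq //; apply: step_act => //; apply: sp.
have sw' : step (q k) (q k.+1) by apply: sq.
move: (g _) (q k.+1) sw sw' => w w' sw sw' {g Gg gpq}.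
apply: contrapT => nh.
have ww' : w <> w'.
  by move=> e; apply: nh; exists id; split=> //; apply: subgroup_id.
suff rig : rigid k by apply: (inf (v := q 0)); apply: rigid_finite rig sqk.
(* The stabilizer of [q] permutes the two successors [w], [w'] of [q k] without sending [w] to [w'],
   so it fixes both. *)
have fixw g u : G g -> fixes g k q -> step (q k) u -> g u = u.
  move=> Gg gq su.
  have sgu t : step (q k) t -> step (q k) (g t).
    by rewrite -{2}(gq k) //; apply: step_act.
  have gw : g w = w.
    case: (step_two sw sw' (sgu _ sw) ww') => // gww'.
    by case: nh; exists g.
  case: (step_two sw sw' su ww') => -> //.
  case: (step_two sw sw' (sgu _ sw') ww') => // gw'.
  by case: ww'; apply: (subgroup_inj Gg); rewrite gw gw'.
(* Conjugation by an element taking [p'] to [q], given by [IH], reduces an arbitrary [k]-path to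
   [q]. *)
move=> p' g u sp' Gg gp' su.
have [h Gh hpq] := IH p' q sp' sqk.
have [h' [Gh' hK h'K]] := subgroup_inverse Gh.
apply: (subgroup_inj Gh); rewrite -{1}[u]hK; apply: (fixw (h \o g \o h')).
- by apply: subgroup_comp => //; apply: subgroup_comp.
- by move=> i ik /=; rewrite -hpq // hK gp'.
- by rewrite -hpq //; apply: step_act.
Qed.

(** * From paths to alternating arcs *)

Definition red_first (n : nat) (a : nat -> Gam) : Prop :=
  forall i, i < n -> if odd i then blue (a i) (a i.+1) else red (a i) (a i.+1).

(* The path attached to [a] is [a 1, a 3, a 5, ...], where the last vertex may
   lie beyond [n]; its images under [r] are [a 0, a 2, a 4, ...]. *)
Lemma red_first_transitive (n : nat) (a b : nat -> Gam) :
  red_first n a -> red_first n b ->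
  exists2 g, G g & forall i, i <= n -> g (a i) = b i.
Proof.
move=> an bn; pose p c i := r (c i.*2) : Gam.
have odd_p c i : red_first n c -> i.*2 < n -> p c i = c i.*2.+1.
  move=> cn /cn; rewrite odd_double; exact: red_uniq.
have sp c : red_first n c -> steps n./2 (p c).
  move=> cn i; rewrite geq_half_double doubleS => i2.
  rewrite odd_p 1?ltnW // /step rK doubleS.
  by have := cn _ i2; rewrite /= odd_double.
have [g Gg gp] := steps_transitive (sp a an) (sp b bn).
exists g => // i ni; have := gp i./2 (half_leq ni).
have := odd_double_half i; case: (odd i) => /= ei.
  by rewrite add1n in ei; rewrite !odd_p ?ei.
by rewrite add0n in ei; rewrite /p ei -r_act // => /(can_inj rK).
Qed.

End Paths.

(** An arc starting with a blue edge is prolonged backwards by the red neighbour of its first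
    vertex, so that both colours reduce to sequences starting with red. *)
Lemma alternating_arc_red_first (s : nat) (c : colour) (r : Gam -> Gam)
    (a : 'I_s.+1 -> Gam) : (forall v, red v (r v)) -> 0 < s ->
  alternating_arcs G s c a ->
  if c is Red then red_first s (fun i => a (inord i))
  else red_first s.+1 (fun i => if i is j.+1 then a (inord j) else r (a ord0)).
Proof.
move=> rP s0 [_ alt c0].
have col i : i < s ->
    has_colour G (if odd i then (if c is Red then Blue else Red) else c)
      [set a (inord i); a (inord i.+1)].
  elim: i => [_|i IH si]; first by have -> : inord 0 = ord0 :> 'I_s.+1
    by apply/val_inj; rewrite /= inordK.
  have := alt (inord i) (inord i.+1) (inord i.+2).
  rewrite !inordK ?ltnS //; try by rewrite ltnW // ltnW.
  move=> /(_ erefl erefl) [d [e [de hd he]]].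
  have hi := IH (ltnW si).
  (* No edge has both colours, so the colours witnessing alternation agree with the one already
     known for edge [i]. *)
  have excl x y :
      has_colour G Red [set x; y] -> has_colour G Blue [set x; y] -> False.
    by move=> /has_colour_Red rxy /has_colour_Blue[].
  rewrite /=; case: (odd i) hi; move: c d e de hd he {IH c0 si};
  by case; case; case=> //= _ h1 h2 h3;
    case: (excl _ _ h1 h3) || case: (excl _ _ h3 h1).
have col' x y d : has_colour G d [set x; y] ->
    if d is Red then red x y else blue x y.
  by case: d => [/has_colour_Red|/has_colour_Blue].
case: c col {c0} => col.
  by move=> i /col; case: (odd i) => /col'.
case=> [_|i] /=; last by move=> /col; case: (odd i) => /col'.
have -> : inord 0 = ord0 :> 'I_s.+1 by apply/val_inj; rewrite /= inordK.
by apply: red_sym.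
Qed.

End InfiniteStabilizers.
End VertexTransitive.

Theorem theorem4p6 (Gam : sgraph) (G : set (Gam -> Gam)) :
  connected_graph Gam ->
  trivalent Gam ->
  subgroup_of_aut G ->
  vertex_transitive G ->
  ~ edge_transitive G ->
  (forall v : Gam, infinite_set (stabilizer G v)) ->
  forall (s : nat) (c : colour), 0 < s ->
    transitive_on G (fun g a => g \o a) (alternating_arcs G s c).
Proof.
move=> conn triv subG vtr netr inf s c s0 a b.
have [r [rP rK rG]] := red_involution conn triv subG vtr netr inf.
have R := alternating_arc_red_first conn triv subG vtr netr inf rP s0.
have T := red_first_transitive conn triv subG vtr netr inf rP rK rG.
move=> /R; case: c => an /R /(T _ _ _ an)[g Gg gab];
  exists g => //; apply/funext => i /=.
  by have := gab i (leq_ord i); rewrite inord_val.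
(* In the blue case the added red edge shifts the indices of the arc by one. *)
by have := gab i.+1 (ltn_ord i); rewrite inord_val.
Qed.
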